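(* The class $\mathsf{FR[1]}$ of frontier-one existential rules is destructive of arity-two QA, even when the whole signature $\sigma$ has arity two and there is no query. That is, the following satisfiability problem is undecidable: given a signature $\sigma$ all of whose relations have arity at most $2$, a $\sigma$-fact $F(\mathbf{x})$, a finite set $\Delta$ of frontier-one rules on $\sigma$, and a $\mathsf{GC}^2$ constraint $\Sigma$ on $\sigma$, decide whether there is an interpretation satisfying $(\exists \mathbf{x}~F(\mathbf{x})) \wedge \Sigma \wedge \Delta$.
   Context: A signature $\sigma$ is a finite set of relation names with arities; $\sigma_{\leq 2}$ and $\sigma_{>2}$ denote its relations of arity $\leq 2$ and $>2$. Atoms use variables only (no constants). A $\sigma$-fact is a finite conjunction of atoms over $\sigma$. A CQ is an existentially quantified finite conjunction of atoms without free variables. Interpretations are relational structures, finite or infinite. QA (query answering): given a fact $F$, constraints $\Theta$ and a CQ $q$, decide whether $\forall \mathbf{x}~(F(\mathbf{x}) \wedge \Theta \rightarrow q)$ is valid over all interpretations. An existential rule is a sentence $\forall \mathbf{x}~(\phi(\mathbf{x}) \rightarrow \exists \mathbf{y}~\psi(\mathbf{x'},\mathbf{y}))$ with $\mathbf{x'} \subseteq \mathbf{x}$, where $\phi$ (body) and $\psi$ (head) are conjunctions of atoms without equality or constants; its frontier is the set $\mathbf{x'}$ of variables occurring in both body and head. The rule is frontier-one (class $\mathsf{FR[1]}$) if its frontier has exactly one variable. $\mathsf{GC}^2$ (two-variable guarded fragment with counting) is the smallest class of constant-free first-order formulas with at most two variables that contains all atoms for relations of $\sigma_{\leq 2}$ and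 is closed under Boolean connectives, under guarded universal and existential quantification (guarded by an atom containing all free variables of the quantified formula), and under number quantification: if $\phi(x,y)$ is in $\mathsf{GC}^2$ and $A(x,y)$ is an arity-two atom with two free variables, then $\exists^{\geq n} y~A(x,y) \wedge \phi(x,y)$ and $\exists^{<n} y~A(x,y) \wedge \phi(x,y)$ are in $\mathsf{GC}^2$, for every integer $n$. A class of existential rules is destructive (of arity-two QA) if QA is undecidable for conjunctions of rules of the class (on $\sigma$) and $\mathsf{GC}^2$ constraints (on $\sigma_{\leq 2}$). *)

(* Defs.v *)
From mathcomp Require Import all_boot.

Set Implicit Arguments.
Unset Strict Implicit.
Unset Printing Implicit Defensive.

(* Kleene's partial recursive functions. *)
Inductive recf : nat -> Type :=
| RZero n : recf n
| RSucc : recf 1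
| RProj n (i : 'I_n) : recf n
| RComp m n (f : recf m) (g : 'I_m -> recf n) : recf n
| RPrim n (f : recf n) (g : recf n.+2) : recf n.+1
| RMin n (f : recf n.+1) : recf n.

(* [rec_eval f v y] : the computation of f on v terminates with value y.
   Primitive recursion is on the first argument, with h its sequence of
   intermediate values; minimisation is over the first argument, and all
   values before the least zero must be defined. *)
Fixpoint rec_eval n (f : recf n) : n.-tuple nat -> nat -> Prop :=
  match f in recf n return n.-tuple nat -> nat -> Prop with
  | RZero _ => fun _ y => y = 0
  | RSucc => fun v y => y = (thead v).+1
  | RProj _ i => fun v y => y = tnth v i
  | RComp m _ f g => fun v y => exists w : m.-tuple nat,
      (forall i, rec_eval (g i) v (tnth w i)) /\ rec_eval f w y
  | RPrim n f g => fun v y => exists h : nat -> nat,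
      [/\ rec_eval f [tuple of behead v] (h 0),
          forall k, k < thead v ->
            rec_eval g [tuple of k :: h k :: behead v] (h k.+1)
        & y = h (thead v)]
  | RMin _ f => fun v y =>
      rec_eval f [tuple of y :: v] 0 /\
      forall z, z < y -> exists k, rec_eval f [tuple of z :: v] k.+1
  end.

(* The decision problem with inputs {i | D i}, presented to the algorithm
   through the Goedel numbering c, and with yes-instances those satisfying P.
   Nothing is required of the algorithm outside D. *)
Definition rec_decidable (I : Type) (c : I -> nat) (D P : I -> Prop) : Prop :=
  exists f : recf 1, forall i, D i ->
    (P i -> rec_eval f [tuple c i] 1) /\ (~ P i -> rec_eval f [tuple c i] 0).

(* The list of arities; the relation names are the positions in the list. *)
Definition signature := seq nat.

Definition relname (s : signature) := 'I_(size s).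

Definition arity (s : signature) (r : relname s) : nat := nth 0 s r.

Record atom (s : signature) (V : Type) := Atom {
  atom_rel : relname s;
  atom_args : (arity atom_rel).-tuple V }.

Record interp (s : signature) := Interp {
  dom :> Type;
  dom_inhabited : inhabited dom;
  rel_of : forall r : relname s, (arity r).-tuple dom -> Prop }.

Definition atom_holds s V (I : interp s) (v : V -> I) (a : atom s V) : Prop :=
  rel_of [tuple of map v (atom_args a)].

Definition conj_atoms (s : signature) := seq (atom s nat).

Definition conj_vars s (c : conj_atoms s) : seq nat :=
  flatten [seq val (atom_args a) | a <- c].

Fixpoint all_Prop (T : Type) (P : T -> Prop) (l : seq T) : Prop :=
  if l is x :: l' then P x /\ all_Prop P l' else True.

Definition conj_holds s (I : interp s) (v : nat -> I) (c : conj_atoms s) : Prop :=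
  all_Prop (atom_holds v) c.

Record rule (s : signature) := Rule {
  rule_body : conj_atoms s;
  rule_head : conj_atoms s }.

(* The variables of the head that do not occur in the body are the
   existentially quantified ones. *)
Definition rule_holds s (I : interp s) (r : rule s) : Prop :=
  forall v : nat -> I, conj_holds v (rule_body r) ->
  exists w : nat -> I,
    (forall x, x \in conj_vars (rule_body r) -> w x = v x) /\ conj_holds w (rule_head r).

Definition frontier s (r : rule s) : seq nat :=
  undup [seq x <- conj_vars (rule_body r) | x \in conj_vars (rule_head r)].

Definition frontier_one s (r : rule s) : Prop := size (frontier r) = 1.

Definition rules_hold s (I : interp s) (d : seq (rule s)) : Prop :=
  all_Prop (rule_holds I) d.

(* The two variables are the booleans. *)
Inductive form (s : signature) : Type :=
| FAtom of atom s bool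
| FNot of form s
| FAnd of form s & form s
| FOr of form s & form s
| FImp of form s & form s
| FAll of bool & form s
| FEx of bool & form s
| FGeq of nat & bool & form s
| FLt of nat & bool & form s.

Definition upd (T : Type) (e : bool -> T) (x : bool) (d : T) : bool -> T :=
  fun y => if y == x then d else e y.

Definition at_least (T : Type) (n : nat) (P : T -> Prop) : Prop :=
  exists g : 'I_n -> T, injective g /\ forall i, P (g i).

Fixpoint holds s (I : interp s) (e : bool -> I) (f : form s) : Prop :=
  match f with
  | FAtom a => atom_holds e a
  | FNot f => ~ holds e f
  | FAnd f g => holds e f /\ holds e g
  | FOr f g => holds e f \/ holds e g
  | FImp f g => holds e f -> holds e g
  | FAll x f => forall d, holds (upd e x d) f
  | FEx x f => exists d, holds (upd e x d) f
  | FGeq n x f => at_least n (fun d => holds (upd e x d) f)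
  | FLt n x f => ~ at_least n (fun d => holds (upd e x d) f)
  end.

Fixpoint free s (f : form s) (x : bool) : bool :=
  match f with
  | FAtom a => x \in val (atom_args a)
  | FNot f => free f x
  | FAnd f g | FOr f g | FImp f g => free f x || free g x
  | FAll y f | FEx y f | FGeq _ y f | FLt _ y f => (x != y) && free f x
  end.

Definition sentence s (f : form s) : Prop := forall x, ~~ free f x.

Definition guards s (a : atom s bool) (f : form s) : Prop :=
  forall x, free f x -> x \in val (atom_args a).

(* zs is the block of variables bound by a guarded quantifier. *)
Inductive gc2 (s : signature) : form s -> Prop :=
| gc2_atom a : arity (atom_rel a) <= 2 -> gc2 (FAtom a)
| gc2_not f : gc2 f -> gc2 (FNot f)
| gc2_and f g : gc2 f -> gc2 g -> gc2 (FAnd f g)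
| gc2_or f g : gc2 f -> gc2 g -> gc2 (FOr f g)
| gc2_imp f g : gc2 f -> gc2 g -> gc2 (FImp f g)
| gc2_all zs a f : arity (atom_rel a) <= 2 -> guards a f -> gc2 f ->
    gc2 (foldr (@FAll s) (FImp (FAtom a) f) zs)
| gc2_ex zs a f : arity (atom_rel a) <= 2 -> guards a f -> gc2 f ->
    gc2 (foldr (@FEx s) (FAnd (FAtom a) f) zs)
| gc2_geq n y a f : perm_eq (atom_args a) [:: false; true] -> gc2 f ->
    gc2 (FGeq n y (FAnd (FAtom a) f))
| gc2_lt n y a f : perm_eq (atom_args a) [:: false; true] -> gc2 f ->
    gc2 (FLt n y (FAnd (FAtom a) f)).

(* A sentence has the same truth value under all assignments. *)
Definition models s (I : interp s) (f : form s) : Prop :=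
  forall e : bool -> I, holds e f.

Record sat_input := SatInput {
  in_sig : signature;
  in_fact : conj_atoms in_sig;
  in_rules : seq (rule in_sig);
  in_constraint : form in_sig }.

Record qa_input := QAInput {
  qa_sat :> sat_input;
  qa_query : conj_atoms (in_sig qa_sat) }.

Definition satisfiable (i : sat_input) : Prop :=
  exists I : interp (in_sig i),
    [/\ exists v : nat -> I, conj_holds v (in_fact i),
        models I (in_constraint i)
      & rules_hold I (in_rules i)].

Definition entailed (i : qa_input) : Prop :=
  forall (I : interp (in_sig i)) (v : nat -> I),
    conj_holds v (in_fact i) ->
    models I (in_constraint i) -> rules_hold I (in_rules i) ->
    exists w : nat -> I, conj_holds w (qa_query i).

(* Goedel numbering, iterating the bijection [CodeSeq.code] between
    [seq nat] and [nat]. *)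
Definition code_atom s V (c : V -> nat) (a : atom s V) : nat :=
  CodeSeq.code (nat_of_ord (atom_rel a) :: map c (atom_args a)).

Definition code_conj s (c : conj_atoms s) : nat :=
  CodeSeq.code (map (code_atom id) c).

Definition code_rule s (r : rule s) : nat :=
  CodeSeq.code [:: code_conj (rule_body r); code_conj (rule_head r)].

Fixpoint code_form s (f : form s) : nat :=
  CodeSeq.code
    match f with
    | FAtom a => [:: 0; code_atom nat_of_bool a]
    | FNot f => [:: 1; code_form f]
    | FAnd f g => [:: 2; code_form f; code_form g]
    | FOr f g => [:: 3; code_form f; code_form g]
    | FImp f g => [:: 4; code_form f; code_form g]
    | FAll x f => [:: 5; nat_of_bool x; code_form f]
    | FEx x f => [:: 6; nat_of_bool x; code_form f]
    | FGeq n x f => [:: 7; n; nat_of_bool x; code_form f]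
    | FLt n x f => [:: 8; n; nat_of_bool x; code_form f]
    end.

Definition code_sat (i : sat_input) : nat :=
  CodeSeq.code [:: CodeSeq.code (in_sig i); code_conj (in_fact i);
    CodeSeq.code (map (@code_rule _) (in_rules i));
    code_form (in_constraint i)].

Definition code_qa (i : qa_input) : nat :=
  CodeSeq.code [:: code_sat i; code_conj (qa_query i)].

Lemma code_atom_inj s V (c : V -> nat) :
  injective c -> injective (@code_atom s V c).
Proof.
move=> cI [r a] [r' a'] /(can_inj CodeSeq.codeK) /= [] /val_inj rr'.
by case: r' / rr' a' => a' /(inj_map cI) /val_inj ->.
Qed.

Lemma code_conj_inj s : injective (@code_conj s).
Proof.
move=> c c' /(can_inj CodeSeq.codeK) /inj_map; apply.
exact: code_atom_inj.
Qed.

Lemma code_rule_inj s : injective (@code_rule s).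
Proof.
move=> [b h] [b' h'] /(can_inj CodeSeq.codeK) [].
by move=> /code_conj_inj -> /code_conj_inj ->.
Qed.

Lemma nat_of_bool_inj : injective nat_of_bool.
Proof. by move=> [] []. Qed.

Lemma code_form_inj s : injective (@code_form s).
Proof.
elim=> [a|f IHf|f IHf g IHg|f IHf g IHg|f IHf g IHg|x f IHf|x f IHf
       |n x f IHf|n x f IHf] [a'|f'|f' g'|f' g'|f' g'|x' f'|x' f'|n' x' f'
       |n' x' f'] /(can_inj CodeSeq.codeK) [] //.
- by move=> /(code_atom_inj nat_of_bool_inj) ->.
- by move=> /IHf ->.
- by move=> /IHf -> /IHg ->.
- by move=> /IHf -> /IHg ->.
- by move=> /IHf -> /IHg ->.
- by move=> /nat_of_bool_inj -> /IHf ->.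
- by move=> /nat_of_bool_inj -> /IHf ->.
- by move=> -> /nat_of_bool_inj -> /IHf ->.
- by move=> -> /nat_of_bool_inj -> /IHf ->.
Qed.

Lemma code_sat_inj : injective code_sat.
Proof.
move=> [s F d f] [s' F' d' f'] /(can_inj CodeSeq.codeK) /= [].
move=> /(can_inj CodeSeq.codeK) ss'; case: s' / ss' F' d' f' => F' d' f'.
move=> /code_conj_inj -> /(can_inj CodeSeq.codeK) /inj_map dd' /code_form_inj ->.
by rewrite (dd' (@code_rule_inj s)).
Qed.

Lemma code_qa_inj : injective code_qa.
Proof.
move=> [i q] [i' q'] /(can_inj CodeSeq.codeK) /= [] /code_sat_inj ii'.
by case: i' / ii' q' => q' /code_conj_inj ->.
Qed.

Definition rule_class := forall s : signature, rule s -> Prop.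

Definition input_in (C : rule_class) (i : sat_input) : Prop :=
  [/\ all_Prop (@C (in_sig i)) (in_rules i),
      gc2 (in_constraint i)
    & sentence (in_constraint i)].

Definition arity_two (i : sat_input) : Prop :=
  forall r : relname (in_sig i), arity r <= 2.

Definition destructive (C : rule_class) : Prop :=
  ~ rec_decidable code_qa (fun i => input_in C i) entailed.

(* Main.v *)
Require Import Defs.
From mathcomp Require Import all_boot.
From Stdlib Require Import FunctionalExtensionality ClassicalEpsilon.

Set Implicit Arguments.
Unset Strict Implicit.
Unset Printing Implicit Defensive.

(* Counting makes the binary relations Inc_0, ..., Inc_(k-1) functional, and
   frontier-one rules whose heads are squares make these functions total and
   commuting, so that the orbit of a root element is a homomorphic image of
   the grid N^k. A unary predicate then represents a k-ary relation on the
   naturals, and frontier-one rules express Horn clauses such as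
   p(x) -> q(Inc_i x), p(Inc_i x) -> q(x) and p(x) /\ p'(x) -> q(x). The graph
   of every partial recursive function is the least model of such clauses, by
   induction on the function. The fact is a path of a steps along Inc_0 and b
   steps along Inc_1 from the root, whose end is forbidden to lie in the
   relation defined by the clauses; hence it is satisfiable with the rules iff
   the relation fails at (a, b). Only the fact depends on (a, b), and the code
   of the whole input is computable from a, b, the code of the signature and
   that of the rules and constraint. Taking a and b to be the latter two codes,
   and for the relation the statement that the supposed decision procedure
   declares this input satisfiable, is contradictory. *)

(** * Computable functions *)

Lemma rec_eval_det n (f : recf n) v y y' :
  rec_eval f v y -> rec_eval f v y' -> y = y'.
Proof.
elim: f v y y' => {n} [n|||m n f IHf g IHg|n f IHf g IHg|n f IHf] /=.
- by move=> v y y' -> ->.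
- by move=> v y y' -> ->.
- by move=> n i v y y' -> ->.
- move=> v y y' [w [gw fw]] [w' [gw' fw']].
  suff ww' : w = w' by rewrite -ww' in fw'; apply: IHf fw fw'.
  by apply: eq_from_tnth => i; apply: IHg (gw i) (gw' i).
- move=> v y y' [h [h0 hS ->]] [h' [h'0 h'S ->]].
  (* By induction on the index, the two sequences of intermediate values agree up to the recursion
     argument; beyond it they are unconstrained. *)
  have: thead v <= thead v by [].
  elim: {1 3 4}(thead v) => [_|k IHk lt_k]; first exact: IHf h0 h'0.
  by have:= h'S k lt_k; rewrite -(IHk (ltnW lt_k)); apply/IHg/hS.
- move=> v y y' [fy lt_y] [fy' lt_y'].
  case: (ltngtP y y') => // [/lt_y'|/lt_y] [k fk].
    by have := IHf _ _ _ fy fk.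
  by have := IHf _ _ _ fy' fk.
Qed.

Definition computable n (F : n.-tuple nat -> nat) : Prop :=
  exists f : recf n, forall v, rec_eval f v (F v).

Lemma computable_ext n (F G : n.-tuple nat -> nat) :
  F =1 G -> computable F -> computable G.
Proof. by move=> FG [f fF]; exists f => v; rewrite -FG. Qed.

Lemma computable_proj n (i : 'I_n) : computable (fun v => tnth v i).
Proof. by exists (RProj i). Qed.

Lemma computable_comp n m (F : m.-tuple nat -> nat)
    (G : 'I_m -> n.-tuple nat -> nat) :
  computable F -> (forall i, computable (G i)) ->
  computable (fun v => F [tuple G i v | i < m]).
Proof.
(* [RComp] takes a family of programs as data, so choice extracts one program per component. *)
move=> [f fF] /(fun H i => constructive_indefinite_description _ (H i)) g.
exists (RComp f (fun i => sval (g i))) => v /=.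
exists [tuple G i v | i < m]; split=> // i.
by rewrite tnth_mktuple; apply: (svalP (g i)).
Qed.

Lemma computable_comp1 n (F : nat -> nat) (G : n.-tuple nat -> nat) :
  computable (fun v : 1.-tuple nat => F (thead v)) -> computable G ->
  computable (fun v => F (G v)).
Proof.
move=> cF cG; apply: computable_ext (computable_comp cF (fun=> cG)) => v.
by rewrite /thead (tnth_mktuple (fun=> G v)).
Qed.

Lemma computable_comp2 n (F : nat -> nat -> nat) (G H : n.-tuple nat -> nat) :
  computable (fun v : 2.-tuple nat => F (thead v) (tnth v (lift ord0 ord0))) ->
  computable G -> computable H -> computable (fun v => F (G v) (H v)).
Proof.
move=> cF cG cH.
pose K (i : 'I_2) := if i == 0 :> nat then G else H.
have cK i : computable (K i) by rewrite /K; case: ifP.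
apply: computable_ext (computable_comp cF cK) => v.
by rewrite /thead !(tnth_mktuple (fun i : 'I_2 => K i v)).
Qed.

Lemma computable_succ n (G : n.-tuple nat -> nat) :
  computable G -> computable (fun v => (G v).+1).
Proof. by move=> cG; apply: (computable_comp1 (F := S)) cG; exists RSucc. Qed.

Lemma computable_const n c : computable (fun _ : n.-tuple nat => c).
Proof.
elim: c => [|c IHc]; first by exists (RZero n).
exact: (computable_succ IHc).
Qed.

Lemma computable_prim n (F : n.-tuple nat -> nat) (G : n.+2.-tuple nat -> nat)
    (P : nat -> n.-tuple nat -> nat) :
  computable F -> computable G -> (forall v, P 0 v = F v) ->
  (forall k v, P k.+1 v = G [tuple of k :: P k v :: v]) ->
  computable (fun v => P (thead v) [tuple of behead v]).
Proof.
move=> [f fF] [g gG] P0 PS; exists (RPrim f g) => v /=.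
exists (fun k => P k [tuple of behead v]); split=> // [|k _].
  by rewrite P0; apply: fF.
by rewrite PS; apply: gG.
Qed.

Lemma computable_prim2 (F : nat -> nat) (G P : nat -> nat -> nat) :
  computable (fun v : 1.-tuple nat => F (thead v)) ->
  computable (fun v : 3.-tuple nat => G (tnth v (lift ord0 ord0)) (tnth v ord_max)) ->
  (forall b, P 0 b = F b) -> (forall a b, P a.+1 b = G (P a b) b) ->
  computable (fun v : 2.-tuple nat => P (thead v) (tnth v (lift ord0 ord0))).
Proof.
move=> cF cG P0 PS.
have := computable_prim (P := fun k v => P k (thead v)) cF cG.
move=> /(_ (fun v => P0 _)) cP; apply: computable_ext (cP _) => [v|k v].
  by case/tupleP: v => a v; case/tupleP: v => b v; rewrite !(tnth_nth 0).
by case/tupleP: v => b v; rewrite PS !(tnth_nth 0).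
Qed.

Lemma computable_double : computable (fun v : 1.-tuple nat => (thead v).*2).
Proof.
apply: (computable_prim (F := fun=> 0)
  (G := fun v => (tnth v (lift ord0 ord0)).+2) (P := fun k _ => k.*2)) => //.
- exact: computable_const.
- by do 2!apply: computable_succ; apply: computable_proj.
Qed.

Lemma computable_add n (F G : n.-tuple nat -> nat) :
  computable F -> computable G -> computable (fun v => F v + G v).
Proof.
apply: computable_comp2.
apply: (computable_prim2 (F := id) (G := fun c _ => c.+1)) => //.
- exact: computable_proj.
- by apply: computable_succ; apply: computable_proj.
Qed.

(** [CodeSeq.code (a :: s)] unfolds to [2 ^ a * (CodeSeq.code s).*2.+1], a primitive recursion on
    [a] that doubles at each step. *)
Lemma computable_code_cons n (F : n.-tuple nat -> nat) (s : n.-tuple nat -> seq nat) :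
  computable F -> computable (fun v => CodeSeq.code (s v)) ->
  computable (fun v => CodeSeq.code (F v :: s v)).
Proof.
move=> cF cs; apply: (computable_comp2 (F := fun a b => 2 ^ a * b.*2.+1)) cF cs.
apply: (computable_prim2 (F := fun b => b.*2.+1) (G := fun c _ => c.*2)
  (P := fun a b => 2 ^ a * b.*2.+1)).
- by apply: computable_succ; apply: computable_double.
- apply: (computable_comp1 (F := double)); first exact: computable_double.
  exact: computable_proj.
- by move=> b; rewrite mul1n.
- by move=> a b; rewrite expnS -mulnA mul2n.
Qed.

(** * Horn clauses on register valuations *)

Lemma all_Prop_cat (T : Type) (P : T -> Prop) s t :
  all_Prop P (s ++ t) <-> all_Prop P s /\ all_Prop P t.
Proof. by elim: s => /= [|x s ->]; tauto. Qed.

Lemma all_Prop_map (T U : Type) (P : U -> Prop) (f : T -> U) s :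
  all_Prop P (map f s) <-> all_Prop (fun x => P (f x)) s.
Proof. by elim: s => //= x s ->. Qed.

Lemma all_Prop_impl (T : Type) (P Q : T -> Prop) s :
  (forall x, P x -> Q x) -> all_Prop P s -> all_Prop Q s.
Proof. by move=> PQ; elim: s => //= x s IHs [/PQ Qx /IHs]. Qed.

Definition valuation := nat -> nat.

Definition setr (x : valuation) (i n : nat) : valuation := fun j => if j == i then n else x j.

Definition inc (i : nat) (x : valuation) : valuation := setr x i (x i).+1.

Lemma setr_eq x i n : setr x i n i = n.
Proof. by rewrite /setr eqxx. Qed.

Lemma setr_neq x i j n : j != i -> setr x i n j = x j.
Proof. by rewrite /setr => /negPf ->. Qed.

Lemma setr_id x i : setr x i (x i) = x.
Proof. by apply: functional_extensionality => j; rewrite /setr; case: eqP => // ->. Qed.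

Lemma setr_setr x i m n : setr (setr x i m) i n = setr x i n.
Proof. by apply: functional_extensionality => j; rewrite /setr; case: eqP. Qed.

Lemma setrC x i j m n : i != j -> setr (setr x i m) j n = setr (setr x j n) i m.
Proof.
move=> ij; apply: functional_extensionality => k; rewrite /setr.
by case: eqP => // ->; rewrite eq_sym (negPf ij).
Qed.

(** The first three tests have a fixed meaning on valuations. Names are lists: prefixing those of
    each component with its own number keeps the components of a combined clause set apart and
    leaves [[::]] for the new output. *)
Inductive upred :=
| PZero of nat
| PEq of nat & nat
| PSucc of nat & nat
| PName of seq nat.

Inductive clause :=
| Up of upred & nat & seq nat
| Down of upred & nat & seq nat
| Conj of upred & upred & seq nat.

Definition ev (J : seq nat -> valuation -> Prop) (p : upred) (x : valuation) : Prop :=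
  match p with
  | PZero a => x a = 0
  | PEq a b => x a = x b
  | PSucc a b => x a = (x b).+1
  | PName s => J s x
  end.

Definition clause_holds (J : seq nat -> valuation -> Prop) (c : clause) : Prop :=
  match c with
  | Up p i s => forall x, ev J p x -> J s (inc i x)
  | Down p i s => forall x, ev J p (inc i x) -> J s x
  | Conj p q s => forall x, ev J p x -> ev J q x -> J s x
  end.

Notation clauses_hold J := (all_Prop (clause_holds J)).

(* The name [::] denotes R in the least model M of the clauses. *)
Definition horn (R : valuation -> Prop) : Prop := exists cs M,
  [/\ clauses_hold M cs, forall x, M [::] x <-> R x
    & forall J, clauses_hold J cs -> forall x, R x -> J [::] x].

Lemma horn_ext R R' : (forall x, R x <-> R' x) -> horn R -> horn R'.
Proof.
move=> RR' [cs [M [Mcs MR Rmin]]]; exists cs, M; split=> // [x|J Jcs x /RR'].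
  by rewrite MR RR'.
exact: Rmin.
Qed.

Lemma horn_ev p : (forall s, p <> PName s) -> horn (ev (fun _ _ => True) p).
Proof.
move=> pP.
have evP J x : ev J p x <-> ev (fun _ _ => True) p x.
  by case: p pP => [a|a b|a b|s /(_ s)] //= _; split.
exists [:: Conj p p [::]], (fun _ => ev (fun _ _ => True) p); split=> /=.
- by split=> // x /evP.
- by [].
- by move=> J [Jp _] x px; apply: Jp; apply/evP.
Qed.

Definition prefix_pred (i : nat) (p : upred) : upred :=
  if p is PName s then PName (i :: s) else p.

Definition prefix_clause (i : nat) (c : clause) : clause :=
  match c with
  | Up p j s => Up (prefix_pred i p) j (i :: s)
  | Down p j s => Down (prefix_pred i p) j (i :: s)
  | Conj p q s => Conj (prefix_pred i p) (prefix_pred i q) (i :: s)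
  end.

Lemma clauses_hold_prefix i J cs :
  clauses_hold J (map (prefix_clause i) cs) <->
  clauses_hold (fun s => J (i :: s)) cs.
Proof.
have ev_prefix p x : ev J (prefix_pred i p) x = ev (fun s => J (i :: s)) p x.
  by case: p.
rewrite all_Prop_map; split; apply: all_Prop_impl => -[p j s|p j s|p q s] /= H x;
  by move: (H x); rewrite !ev_prefix.
Qed.

Lemma horn_and R R' : horn R -> horn R' -> horn (fun x => R x /\ R' x).
Proof.
move=> [cs [M [Mcs MR Rmin]]] [cs' [M' [M'cs' M'R' R'min]]].
exists (map (prefix_clause 0) cs ++ map (prefix_clause 1) cs' ++
        [:: Conj (PName [:: 0]) (PName [:: 1]) [::]]).
exists (fun s => match s with
  | 0 :: s => M s | 1 :: s => M' s | _ => fun x => R x /\ R' x end).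
split=> // [|J]; rewrite !all_Prop_cat !clauses_hold_prefix //=.
  by do ![apply: conj=> //] => x /MR Rx /M'R'.
by move=> [Jcs [Jcs' [JC _]]] x [Rx R'x]; apply: JC; [apply: (Rmin _ Jcs)|apply: (R'min _ Jcs')].
Qed.

(** [Up] and [Down] on register [w] carry the output in both directions along [w]: from the witness
    down to 0, then up to the actual content. *)
Lemma horn_ex R w : horn R -> horn (fun x => exists n, R (setr x w n)).
Proof.
move=> [cs [M [Mcs MR Rmin]]].
exists (map (prefix_clause 0) cs ++
  [:: Conj (PName [:: 0]) (PName [:: 0]) [::];
      Up (PName [::]) w [::]; Down (PName [::]) w [::]]).
exists (fun s => if s is 0 :: s then M s else fun x => exists n, R (setr x w n)).
split=> // [|J]; rewrite !all_Prop_cat !clauses_hold_prefix //=.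
  do ![apply: conj=> //] => x.
  - by move=> /MR Rx _; exists (x w); rewrite setr_id.
  - by move=> [n Rx]; exists n; rewrite /inc setr_setr.
  - by move=> [n]; rewrite /inc setr_setr; exists n.
move=> [Jcs [JC [JU [JD _]]]] x [n Rx].
have {}Rx : J [::] (setr x w n) by apply: JC; apply: (Rmin _ Jcs).
have {n Rx} R0 : J [::] (setr x w 0).
  elim: n Rx => // n IHn Rx; apply/IHn/JD.
  by rewrite /inc setr_eq setr_setr.
rewrite -(setr_id x w); elim: (x w) => // n /JU.
by rewrite /inc setr_eq setr_setr.
Qed.

Lemma horn_exs R (ws : seq nat) : horn R ->
  horn (fun x => exists y, (forall j, j \notin ws -> y j = x j) /\ R y).
Proof.
elim: ws R => [|w ws IHws] R hR.
  apply: horn_ext hR => x; split=> [Rx|[y [yx Ry]]]; first by exists x.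
  by rewrite -(functional_extensionality y x) // => j; apply: yx.
apply: horn_ext (IHws _ (horn_ex w hR)) => x; split.
  move=> [y [yx [n Ry]]]; exists (setr y w n); split=> // j.
  by rewrite inE negb_or => /andP[jw jws]; rewrite setr_neq // yx.
move=> [y [yx Ry]]; exists (setr y w (x w)); split=> [j jws|]; last first.
  by exists (y w); rewrite setr_setr setr_id.
rewrite /setr; case: eqP => [->//|/eqP jw].
by rewrite yx // inE negb_or jw.
Qed.

Lemma horn_all m (R : 'I_m -> valuation -> Prop) :
  (forall i, horn (R i)) -> horn (fun x => forall i, R i x).
Proof.
elim: m R => [|m IHm] R hR.
  (* The empty conjunction is the valid test that register 0 equals itself. *)
  apply: horn_ext (horn_ev (p := PEq 0 0) _) => // x.
  by split=> // _ [].
apply: horn_ext (horn_and (hR ord0) (IHm _ (fun i => hR (lift ord0 i)))) => x.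
split=> [[R0 RS] i|Rx]; last by split=> // i; apply: Rx.
by case: (unliftP ord0 i) => [j|] ->.
Qed.

(** Primitive recursion as a relation: [a] is the recursion argument, [t] the previous value and [r]
    the result; [B] is the graph of the base, [G] that of the step. *)
Definition iterated (B G : valuation -> Prop) (a t r : nat) (x : valuation) : Prop :=
  exists h : nat -> nat,
  [/\ B (setr (setr x a 0) r (h 0)),
      forall k, k < x a -> G (setr (setr (setr x a k) t (h k)) r (h k.+1))
    & x r = h (x a)].

(* The intermediate names are [:: 2], for P with the output in t, and
   [:: 3], for one step of the iteration before the counter is increased. *)
Lemma horn_iterated B G a t r : a != t -> a != r -> t != r ->
  (forall x n, B x <-> B (setr x t n)) ->
  horn B -> horn G -> horn (iterated B G a t r).
Proof.
move=> at_ ar tr Bt [cs [M [Mcs MR Rmin]]] [cs' [M' [M'cs' M'R' R'min]]].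
have [ta ra rt] : [/\ t != a, r != a & r != t] by split; rewrite eq_sym.
set P := iterated B G a t r.
have Pt x n : P x <-> P (setr x t n).
  rewrite /P /iterated !(setr_neq _ _ at_) !(setr_neq _ _ rt).
  split=> -[h [hB hG hr]]; exists h; split=> //.
  - by rewrite (setrC _ _ _ ta) (setrC _ _ _ tr); apply: (proj1 (Bt _ n)).
  - by move=> k /hG; rewrite (setrC _ _ _ ta) [setr (setr _ t n) t _]setr_setr.
  - by move: hB; rewrite (setrC _ _ _ ta) (setrC _ _ _ tr) => /(proj2 (Bt _ n)).
  - by move=> k /hG; rewrite (setrC _ _ _ ta) [setr (setr _ t n) t _]setr_setr.
exists (map (prefix_clause 0) cs ++ map (prefix_clause 1) cs' ++
  [:: Conj (PZero a) (PName [:: 0]) [::];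
      Conj (PName [::]) (PEq t r) [:: 2];
      Up (PName [:: 2]) r [:: 2]; Down (PName [:: 2]) r [:: 2];
      Conj (PName [:: 2]) (PName [:: 1]) [:: 3];
      Up (PName [:: 3]) t [:: 3]; Down (PName [:: 3]) t [:: 3];
      Up (PName [:: 3]) a [::]]).
exists (fun s => match s with
  | 0 :: s => M s | 1 :: s => M' s
  | 2 :: _ => fun x => P (setr x r (x t))
  | 3 :: _ => fun x => exists n, P (setr (setr x t n) r n) /\ G (setr x t n)
  | _ => P end).
split=> // [|J]; rewrite !all_Prop_cat !clauses_hold_prefix /=.
  do ![apply: conj=> //] => x.
  - move=> xa /MR Bx; exists (fun _ => x r).
    by rewrite xa -{1}xa !setr_id.
  - by move=> Px ->; rewrite setr_id.
  - by rewrite /inc setr_setr setr_neq.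
  - by rewrite /inc setr_setr setr_neq.
  - by move=> Px /M'R' Gx; exists (x t); rewrite setr_id.
  - by move=> [n [Px Gx]]; exists n; rewrite /inc !setr_setr.
  - by move=> [n]; rewrite /inc !setr_setr; exists n.
  - move=> [n [[h []]]].
    rewrite !setr_eq !(setr_neq _ _ ar) !(setr_neq _ _ at_).
    rewrite (setrC _ _ _ ra) (setrC _ _ _ ta) setr_setr.
    rewrite (setrC _ _ _ tr) => /(proj2 (Bt _ n)) hB hG hn Gx.
    (* The history is extended by the value just computed, at the index that the counter is about to
       reach. *)
    exists (fun k => if k == (x a).+1 then x r else h k); split.
    + by rewrite /inc setr_setr.
    + move=> k; rewrite /inc setr_eq eqSS ltnS leq_eqVlt.
      case: eqP => [->|/eqP kx] /=.
        by move=> _; rewrite ltn_eqF // setr_setr setr_id -hn -(setr_neq x n rt) setr_id.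
      move=> lt_k; have := hG k lt_k.
      rewrite ltn_eqF ?ltnS 1?ltnW // setr_setr.
      by rewrite (setrC _ _ _ ra) (setrC _ _ _ ta) [setr (setr (setr _ _ _) r n) _ _](setrC _ _ _ rt)
        !setr_setr.
    + by rewrite /inc setr_eq eqxx setr_neq.
move=> [Jcs [Jcs' [J0 [J2 [J2U [J2D [J3 [J3U [J3D [JS _]]]]]]]]]].
(* Once [t] has a copy of the value, register [r] is free: it is driven down to 0 and up to any
   [m]. *)
have J2P y n m : J [::] (setr (setr y t n) r n) -> J [:: 2] (setr (setr y t n) r m).
  move=> Jy; have {Jy} : J [:: 2] (setr (setr y t n) r n).
    by apply: J2 Jy _ => /=; rewrite setr_eq setr_neq // setr_eq.
  move=> J2y; have {J2y} J20 : J [:: 2] (setr (setr y t n) r 0).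
    elim: {2}n J2y => // p IHp J2y; apply/IHp/J2D.
    by rewrite /inc setr_eq setr_setr.
  by elim: m => // m /J2U; rewrite /inc setr_eq setr_setr.
have J3P y n m : J [:: 3] (setr y t n) -> J [:: 3] (setr y t m).
  move=> J3y; have {n J3y} J30 : J [:: 3] (setr y t 0).
    elim: n J3y => // n IHn J3y; apply/IHn/J3D.
    by rewrite /inc setr_eq setr_setr.
  by elim: m => // m /J3U; rewrite /inc setr_eq setr_setr.
move=> x [h [hB hG hr]].
(* The content [m] of [t] stays arbitrary in the induction, because the next step needs it to be
   [h k]. *)
have JP k m : k <= x a -> J [::] (setr (setr (setr x t m) a k) r (h k)).
  elim: k m => [|k IHk] m le_k.
    apply: J0; first by rewrite /= setr_neq // setr_eq.
    apply: (Rmin _ Jcs); rewrite (setrC _ _ _ ta) (setrC _ _ _ tr).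
    exact: (proj1 (Bt _ m)).
  have := IHk (h k) (ltnW le_k).
  rewrite (setrC _ _ _ ta) => /(J2P _ _ (h k.+1)) J2x.
  have /(J3 _ J2x) := R'min _ Jcs' _ (hG k le_k).
  rewrite (setrC _ _ _ tr) => /(J3P _ _ m) /JS.
  rewrite /inc -(setrC _ _ _ tr) -(setrC _ _ _ ta) !(setrC _ _ _ ra) setr_setr.
  by rewrite setr_neq // setr_eq.
have := JP _ (x t) (leqnn _).
by rewrite setr_id setr_id -hr setr_id.
Qed.

(** Bounded quantification is an iteration with a true base and a step relation that does not read
    the stored values, so a constant sequence serves as history. *)
Lemma horn_forall_lt G a t r : a != t -> a != r -> t != r ->
  (forall x m n, G x <-> G (setr (setr x t m) r n)) -> horn G ->
  horn (fun x => forall k, k < x a -> G (setr x a k)).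
Proof.
move=> at_ ar tr Gtr hG.
have h_true : horn (fun=> True).
  by apply: horn_ext (horn_ev (p := PEq 0 0) _) => // x.
have h_it := horn_iterated at_ ar tr (fun _ _ => iff_refl True) h_true hG.
apply: horn_ext h_it => x; split=> [[h [_ Gx _]] k /Gx|Gx].
  by move=> G'; apply/Gtr/G'.
by exists (fun=> x r); split=> // k /Gx Gk; apply: (proj1 (Gtr _ _ _)).
Qed.

(** * Graphs of partial recursive functions *)

Lemma map_setr x i n (s : seq nat) : i \notin s -> map (setr x i n) s = map x s.
Proof.
move=> ins; apply/eq_in_map => j js.
by rewrite setr_neq //; apply: contraNneq ins => <-.
Qed.

(** Supplies scratch registers, and later bounds on the registers and symbol codes of a clause
    set. *)
Lemma fresh (s : seq nat) : exists m, forall j, j \in s -> j < m.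
Proof. by exists (\max_(j <- s) j).+1 => j js; rewrite ltnS (leq_bigmax_seq j). Qed.

Lemma eq_rec_eval n (f : recf n) (v w : n.-tuple nat) (y z : nat) :
  v = w :> seq nat -> y = z -> rec_eval f v y -> rec_eval f w z.
Proof. by move=> /val_inj -> ->. Qed.

(** Induction on [f]. Composition existentially quantifies fresh registers for the intermediate
    results, primitive recursion is [iterated], and minimisation is a zero test together with a
    bounded quantification over the smaller arguments. Distinctness of the registers keeps an
    assignment to one of them from changing another. *)
Lemma horn_rec_eval n (f : recf n) (args : n.-tuple nat) (r : nat) :
  uniq (r :: args) -> horn (fun x => rec_eval f [tuple of map x args] (x r)).
Proof.
elim: f args r => {n} [n|||m n f IHf g IHg|n f IHf g IHg|n f IHf] /=.
- by move=> args r _; apply: (horn_ev (p := PZero r)).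
- move=> args r _; apply: horn_ext (horn_ev (p := PSucc r (thead args)) _) => // x /=.
  by rewrite /thead tnth_map.
- move=> n i args r _.
  apply: horn_ext (horn_ev (p := PEq r (tnth args i)) _) => // x /=.
  by rewrite tnth_map.
- move=> args r /andP[r_args args_uniq].
  have [b lt_b] := fresh (r :: args).
  pose ws : m.-tuple nat := [tuple b + i | i < m].
  have ws_fresh j : j \in r :: args -> j \notin ws.
    move=> /lt_b; apply: contraTN => /tnthP[i ->].
    by rewrite tnth_mktuple -leqNgt leq_addr.
  have ws_uniq : uniq ws.
    by rewrite map_inj_uniq ?enum_uniq // => i j /addnI /val_inj.
  have h_g i : horn (fun x => rec_eval (g i) [tuple of map x args] (x (tnth ws i))).
    apply: IHg; rewrite /= args_uniq andbT.
    apply: contraL (mem_tnth i ws) => i_args.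
    by apply: ws_fresh; rewrite inE i_args orbT.
  have h_f : horn (fun x => rec_eval f [tuple of map x ws] (x r)).
    by apply: IHf; rewrite /= ws_uniq andbT ws_fresh ?mem_head.
  apply: horn_ext (horn_exs ws (horn_and (horn_all h_g) h_f)) => x; split.
    move=> [y [yx [g_y f_y]]]; exists [tuple of map y ws].
    have yr : y r = x r by rewrite yx // ws_fresh ?mem_head.
    have yargs : [tuple of map y args] = [tuple of map x args].
      apply: val_inj; apply/eq_in_map => j j_args.
      by rewrite yx // ws_fresh // inE j_args orbT.
    split=> [i|]; last by rewrite -yr.
    by rewrite tnth_map -yargs.
  move=> [w [g_w f_w]].
  (* The intermediate results [w] are stored in the block of fresh registers starting at [b]. *)
  pose y j := if j \in ws then nth 0 w (j - b) else x j.
  have y_args : [tuple of map y args] = [tuple of map x args].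
    apply: val_inj; apply/eq_in_map => j j_args.
    by rewrite /y (negPf (ws_fresh j _)) // inE j_args orbT.
  have y_ws i : y (tnth ws i) = tnth w i.
    by rewrite /y mem_tnth tnth_mktuple addKn (tnth_nth 0).
  exists y; split=> [j /negPf y_j|]; first by rewrite /y y_j.
  split=> [i|]; first by rewrite y_args y_ws.
  have -> : y r = x r by rewrite /y (negPf (ws_fresh r _)) ?mem_head.
  suff -> : [tuple of map y ws] = w by [].
  by apply: eq_from_tnth => i; rewrite tnth_map y_ws.
- case/tupleP=> a args r.
  rewrite /= inE negb_or => /and3P[/andP[ra r_args] a_args args_uniq].
  (* The fresh register [t] passes the previous value to the step function. *)
  have [t lt_t] := fresh [:: r, a & args].
  have [tr ta t_args] : [/\ t != r, t != a & t \notin args].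
    split; first by rewrite gtn_eqF // lt_t ?mem_head.
      by rewrite gtn_eqF // lt_t // !inE eqxx orbT.
    by apply/negP => ts; have := lt_t t; rewrite !inE ts !orbT ltnn => /(_ isT).
  have h_f : horn (fun x => rec_eval f [tuple of map x args] (x r)).
    by apply: IHf; rewrite /= r_args.
  have h_g : horn (fun x => rec_eval g [tuple of map x [tuple of [:: a, t & args]]] (x r)).
    by apply: IHg; rewrite /= !inE !negb_or (eq_sym r t) (eq_sym a t) ra tr r_args ta a_args t_args.
  have [at_ ar rt] : [/\ a != t, a != r & r != t] by split; rewrite eq_sym.
  have f_t x p : rec_eval f [tuple of map x args] (x r) <->
      rec_eval f [tuple of map (setr x t p) args] (setr x t p r).
    have xr : setr x t p r = x r by rewrite setr_neq.
    by split; apply: eq_rec_eval; rewrite /= ?map_setr ?xr.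
  apply: horn_ext (horn_iterated at_ ar tr f_t h_f h_g) => x.
  have E p q s : map (setr (setr (setr x a p) t q) r s) [:: a, t & args] =
      [:: p, q & map x args].
    rewrite /= !map_setr // (setr_neq _ _ tr) setr_eq.
    by rewrite (setr_neq _ _ ar) (setr_neq _ _ at_) setr_eq.
  split=> -[h [h0 hS hr]]; exists h; split=> //.
  + by apply: eq_rec_eval h0; rewrite /= ?map_setr ?setr_eq.
  + by move=> k /hS; apply: eq_rec_eval; [apply: E|apply: setr_eq].
  + by apply: eq_rec_eval h0; rewrite /= ?map_setr ?setr_eq.
  + by move=> k /hS; apply: eq_rec_eval; [exact/esym/E|rewrite setr_eq].
- move=> args r /andP[r_args args_uniq].
  have [z lt_z] := fresh (r :: args).
  have z_args p : p + z \notin args.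
    apply/negP => ps; have := lt_z (p + z).
    by rewrite inE ps orbT ltnNge leq_addl => /(_ isT).
  (* Register [z] is the search argument, [t] receives the value of [f] and [u] the predecessor of a
     positive value. The bounded quantification over [z] uses [u] and [d] as scratch registers. *)
  pose t := z.+1; pose u := z.+2; pose d := z.+3.
  have h_f : horn (fun x => rec_eval f [tuple of map x [tuple of z :: args]] (x t)).
    apply: IHf; rewrite /= inE negb_or (z_args 0) args_uniq andbT.
    by rewrite (z_args 1) gtn_eqF.
  have f_t x p : rec_eval f [tuple of map (setr x t p) [tuple of z :: args]] (setr x t p t) <->
      rec_eval f [tuple of x z :: map x args] p.
    have E : map (setr x t p) (z :: args) = x z :: map x args.
      by rewrite /= map_setr ?(z_args 1) // setr_neq // ltn_eqF.
    by split; apply: eq_rec_eval; rewrite ?setr_eq ?E // -E.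
  have h_zero : horn (fun x => rec_eval f [tuple of x z :: map x args] 0).
    apply: horn_ext (horn_ex t (horn_and h_f (horn_ev (p := PZero t) _))) => // x.
    split=> [[p [/f_t fx]]|fx] /=; first by rewrite setr_eq => <-.
    by exists 0; split; [apply/f_t|rewrite setr_eq].
  have h_pos : horn (fun x => exists k, rec_eval f [tuple of x z :: map x args] k.+1).
    have h := horn_and h_f (horn_ev (p := PSucc t u) _).
    apply: horn_ext (horn_ex u (horn_ex t (h _))) => // x.
    have f_u q p : rec_eval f [tuple of setr x u q z :: map (setr x u q) args] p <->
        rec_eval f [tuple of x z :: map x args] p.
      have E : setr x u q z :: map (setr x u q) args = x z :: map x args.
        by rewrite map_setr ?(z_args 2) // setr_neq // ltn_eqF.
      by split; apply: eq_rec_eval; rewrite ?E // -E.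
    split=> [[q [p [/f_t/f_u fx]]]|[k fx]] /=.
      by rewrite setr_eq => Ep; exists (setr (setr x u q) t p u); rewrite -Ep.
    exists k, k.+1; split; first exact/f_t/f_u.
    by rewrite setr_eq setr_neq ?setr_eq // gtn_eqF.
  have zu : z != u by rewrite ltn_eqF.
  have zd : z != d by rewrite ltn_eqF // ltnW.
  have ud : u != d by rewrite ltn_eqF.
  have f_ud x m p : (exists k, rec_eval f [tuple of x z :: map x args] k.+1) <->
      (exists k, rec_eval f [tuple of setr (setr x u m) d p z ::
                                      map (setr (setr x u m) d p) args] k.+1).
    have E : setr (setr x u m) d p z :: map (setr (setr x u m) d p) args = x z :: map x args.
      by rewrite !map_setr ?(z_args 2) ?(z_args 3) // !setr_neq.
    by split=> -[k fx]; exists k; apply: eq_rec_eval fx; rewrite // E.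
  have h_all := horn_forall_lt zu zd ud f_ud h_pos.
  have h_eq := horn_ev (p := PEq z r) _.
  apply: horn_ext (horn_ex z (horn_and (h_eq _) (horn_and h_zero h_all))) => //= x.
  have E p : map (setr x z p) args = map x args by rewrite map_setr ?(z_args 0).
  have rz : r != z by rewrite ltn_eqF // lt_z ?mem_head.
  have xr p : setr x z p r = x r by rewrite setr_neq.
  split=> [[p []]|[f0 fS]].
    rewrite setr_eq xr => -> [f0 fS]; split; first by apply: eq_rec_eval f0; rewrite /= ?E.
    move=> k lt_k; have [q fq] := fS k lt_k.
    by exists q; apply: eq_rec_eval fq; rewrite //= setr_setr ?setr_eq E.
  exists (x r); rewrite setr_eq xr; do 2?split=> //.
    by apply: eq_rec_eval f0; rewrite /= ?E.
  by move=> k /fS[q fq]; exists q; apply: eq_rec_eval fq; rewrite //= setr_setr ?setr_eq E.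
Qed.

(** * Frontier-one rules on binary relations *)

(** Descends by successor tests through the registers [r], [r.+1], ..., each bound existentially,
    until a zero test. *)
Lemma horn_const r w : horn (fun x => x r = w).
Proof.
elim: w r => [|w IHw] r; first exact: (horn_ev (p := PZero r)).
have h := horn_and (IHw r.+1) (horn_ev (p := PSucc r r.+1) _).
apply: horn_ext (horn_ex r.+1 (h _)) => // x.
have rr : r != r.+1 by rewrite ltn_eqF.
split=> [[n]|xr] /=; first by rewrite setr_eq (setr_neq _ _ rr) => -[->].
by exists w; rewrite setr_eq (setr_neq _ _ rr).
Qed.

(** [Root] marks the origin, [Goal] the end of the path of the fact, and [Dom] the elements where
    successors are generated and required to be unique. *)
Inductive sym := Inc of nat | Goal | Dom | Root | Holds of upred.

Definition sym_code (s : sym) : nat :=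
  CodeSeq.code match s with
  | Inc i => [:: 0; i]
  | Goal => [:: 1]
  | Dom => [:: 2]
  | Root => [:: 3]
  | Holds (PZero a) => [:: 4; a]
  | Holds (PEq a b) => [:: 5; a; b]
  | Holds (PSucc a b) => [:: 6; a; b]
  | Holds (PName n) => 7 :: n
  end.

Definition sym_decode (m : nat) : option sym :=
  match CodeSeq.decode m with
  | [:: 0; i] => Some (Inc i)
  | [:: 1] => Some Goal
  | [:: 2] => Some Dom
  | [:: 3] => Some Root
  | [:: 4; a] => Some (Holds (PZero a))
  | [:: 5; a; b] => Some (Holds (PEq a b))
  | [:: 6; a; b] => Some (Holds (PSucc a b))
  | 7 :: n => Some (Holds (PName n))
  | _ => None
  end.

Lemma sym_codeK : pcancel sym_code sym_decode.
Proof. by rewrite /sym_code /sym_decode => -[i||||[a|a b|a b|n]]; rewrite CodeSeq.codeK. Qed.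

(* A unary predicate is represented by the diagonal of a binary relation. *)
Definition binsig (N : nat) : signature := nseq N.+1 2.

Lemma arity_binsig N (r : relname (binsig N)) : arity r = 2.
Proof.
have := ltn_ord r; rewrite /arity [X in _ < X]size_nseq => r_lt.
by rewrite nth_nseq r_lt.
Qed.

(* A junk value if N < sym_code s. *)
Definition symrel N (s : sym) : relname (binsig N) := inord (sym_code s).

Lemma val_symrel N s : sym_code s <= N -> symrel N s = sym_code s :> nat.
Proof. by move=> sN; rewrite inordK // ltnS [X in _ <= X](size_nseq N 2). Qed.

Lemma size_pair_args N (r : relname (binsig N)) T (x y : T) :
  size [:: x; y] == arity r.
Proof. by rewrite arity_binsig. Qed.

Definition pair_args N (r : relname (binsig N)) T (x y : T) := Tuple (size_pair_args r x y).

Definition binatom N T (s : sym) (x y : T) : atom (binsig N) T :=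
  Atom (pair_args (symrel N s) x y).

Definition interp_rel N (I : interp (binsig N)) (s : sym) (x y : I) : Prop :=
  rel_of (pair_args (symrel N s) x y).

Lemma atom_holds_binatom N (I : interp (binsig N)) T (v : T -> I) s x y :
  atom_holds v (binatom N s x y) <-> interp_rel s (v x) (v y).
Proof.
rewrite /atom_holds /interp_rel.
suff -> : [tuple of map v (atom_args (binatom N s x y))] =
  pair_args (symrel N s) (v x) (v y) by [].
exact: val_inj.
Qed.

Definition fact_atom N (a : sym * nat * nat) : atom (binsig N) nat :=
  binatom N a.1.1 a.1.2 a.2.

(** In every shape, variable 0 is the frontier. Closing two given edges to a square would need two
    frontier variables; [GSquare] instead creates a whole square at one element, and functionality
    of the increments merges it with the existing edges. The successor created by [GUp] is
    identified in the same way. *)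
Inductive grule :=
| GUp of sym & nat & sym
| GDown of sym & nat & sym
| GConj of sym & sym & sym
| GSquare of nat & nat.

Definition grule_rule N (r : grule) : rule (binsig N) :=
  let at_ := @binatom N nat in
  match r with
  | GUp p i q => Rule [:: at_ p 0 0] [:: at_ (Inc i) 0 1; at_ q 1 1]
  | GDown p i q => Rule [:: at_ (Inc i) 0 1; at_ p 1 1] [:: at_ q 0 0]
  | GConj p p' q => Rule [:: at_ p 0 0; at_ p' 0 0] [:: at_ q 0 0]
  | GSquare i j => Rule [:: at_ Dom 0 0]
      [:: at_ (Inc i) 0 1; at_ (Inc j) 1 2; at_ (Inc j) 0 3; at_ (Inc i) 3 2; at_ Dom 1 1]
  end.

Definition grule_syms (r : grule) : seq sym :=
  match r with
  | GUp p i q | GDown p i q => [:: p; Inc i; q]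
  | GConj p p' q => [:: p; p'; q]
  | GSquare i j => [:: Dom; Inc i; Inc j]
  end.

Definition grule_holds T (A : sym -> T -> T -> Prop) (r : grule) : Prop :=
  match r with
  | GUp p i q => forall x, A p x x -> exists y, A (Inc i) x y /\ A q y y
  | GDown p i q => forall x y, A (Inc i) x y -> A p y y -> A q x x
  | GConj p p' q => forall x, A p x x -> A p' x x -> A q x x
  | GSquare i j => forall x, A Dom x x -> exists y z y',
      A (Inc i) x y /\ A (Inc j) y z /\ A (Inc j) x y' /\ A (Inc i) y' z /\ A Dom y y
  end.

Lemma frontier_one_grule N r : frontier_one (grule_rule N r).
Proof. by case: r. Qed.

Lemma rule_holds_grule N (I : interp (binsig N)) r :
  rule_holds I (grule_rule N r) <-> grule_holds (@interp_rel N I) r.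
Proof.
case: r => [p i q|p i q|p p' q|i j]; rewrite /rule_holds /conj_holds /=.
- split=> [H x px|H v].
    have [|w [wx]] := H (fun=> x); first by rewrite !atom_holds_binatom.
    rewrite !atom_holds_binatom (wx 0) // => -[ix [qx _]].
    by exists (w 1).
  rewrite !atom_holds_binatom => -[/H[y [ix qy]] _].
  exists (fun n => if n == 0 then v 0 else y); rewrite !atom_holds_binatom.
  by split=> // n; rewrite !inE => /orP[] /eqP ->.
- split=> [H x y ixy py|H v].
    have [|w [wx]] := H (fun n => if n == 0 then x else y).
      by rewrite !atom_holds_binatom.
    by rewrite !atom_holds_binatom (wx 0) // => -[].
  rewrite !atom_holds_binatom => -[ixy [py _]]; exists v.
  by rewrite !atom_holds_binatom; do !split=> //; apply: H ixy py.
- split=> [H x px p'x|H v].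
    have [|w [wx]] := H (fun=> x); first by rewrite !atom_holds_binatom.
    by rewrite !atom_holds_binatom (wx 0) // => -[].
  rewrite !atom_holds_binatom => -[px [p'x _]]; exists v.
  by rewrite !atom_holds_binatom; do !split=> //; apply: H.
- split=> [H x px|H v].
    have [|w [wx]] := H (fun=> x); first by rewrite !atom_holds_binatom.
    rewrite !atom_holds_binatom (wx 0) // => -[? [? [? [? [? _]]]]].
    by exists (w 1), (w 2), (w 3).
  rewrite !atom_holds_binatom => -[/H[y [z [y' [? [? [? [? ?]]]]]]] _].
  (* The default of [nth] is the value of variable 3. *)
  exists (fun n => nth y' [:: v 0; y; z] n); rewrite !atom_holds_binatom /=.
  by split=> // n; rewrite !inE => /orP[] /eqP ->.
Qed.

Lemma grule_holds_ext T (A A' : sym -> T -> T -> Prop) (P : sym -> Prop) r :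
  (forall s x y, P s -> (A s x y <-> A' s x y)) -> all_Prop P (grule_syms r) ->
  grule_holds A r <-> grule_holds A' r.
Proof.
move=> AA'; case: r => [p i q|p i q|p p' q|i j] /= [/AA' Ep [/AA' Ei [/AA' Eq _]]];
  setoid_rewrite Ep; setoid_rewrite Ei; setoid_rewrite Eq; reflexivity.
Qed.

(** * The grid *)

Lemma all_PropP (T : eqType) (P : T -> Prop) s :
  all_Prop P s <-> forall x, x \in s -> P x.
Proof.
elim: s => [|y s IHs] //=; rewrite IHs; split=> [[Py Ps] x|Ps].
  by rewrite inE => /predU1P[->|/Ps].
by split=> [|x xs]; apply: Ps; rewrite inE ?eqxx ?xs ?orbT.
Qed.

Lemma all_Prop_flatten T (P : T -> Prop) ss :
  all_Prop P (flatten ss) <-> all_Prop (all_Prop P) ss.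
Proof. by elim: ss => //= s ss IHss; rewrite all_Prop_cat IHss. Qed.

Lemma all_Prop_iota P k : all_Prop P (iota 0 k) <-> forall i, i < k -> P i.
Proof. by rewrite all_PropP; split=> H i; move: (H i); rewrite mem_iota. Qed.

Lemma all_Prop_and T (P Q : T -> Prop) s :
  all_Prop P s -> all_Prop Q s -> all_Prop (fun x => P x /\ Q x) s.
Proof. by elim: s => //= x s IHs [Px Ps] [Qx Qs]; split=> //; apply: IHs. Qed.

(** Rules can only force a test to hold, never to fail; this suffices since clauses use tests
    positively. Zero holds at the root and survives increments of the other registers. *)
Definition zero_grules (k a : nat) : seq grule :=
  let Z := Holds (PZero a) in
  GConj Root Root Z :: [seq GUp Z j Z | j <- iota 0 k & j != a].

(** For distinct registers, incrementing [a] and then [b] leads from equality through successor back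
    to equality; other increments preserve equality. For [a = b], equality holds everywhere and
    successor nowhere. *)
Definition eq_grules (k a b : nat) : seq grule :=
  let E := Holds (PEq a b) in let S := Holds (PSucc a b) in
  if a == b then [:: GConj Dom Dom E] else
  [:: GConj Root Root E, GUp E a S, GUp S b E &
      [seq GUp E j E | j <- iota 0 k & (j != a) && (j != b)]].

Definition clause_grule (c : clause) : grule :=
  match c with
  | Up p i s => GUp (Holds p) i (Holds (PName s))
  | Down p i s => GDown (Holds p) i (Holds (PName s))
  | Conj p q s => GConj (Holds p) (Holds q) (Holds (PName s))
  end.

Definition grules (k : nat) (cs : seq clause) : seq grule :=
  flatten [seq [seq GSquare i j | j <- iota 0 k] | i <- iota 0 k] ++
  flatten [seq zero_grules k a | a <- iota 0 k] ++
  flatten [seq flatten [seq eq_grules k a b | b <- iota 0 k] | a <- iota 0 k] ++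
  map clause_grule cs.

Lemma all_Prop_grules P k cs : all_Prop P (grules k cs) <->
  [/\ forall i j, i < k -> j < k -> P (GSquare i j),
      forall a, a < k -> all_Prop P (zero_grules k a),
      forall a b, a < k -> b < k -> all_Prop P (eq_grules k a b)
    & all_Prop (fun c => P (clause_grule c)) cs].
Proof.
rewrite !all_Prop_cat !all_Prop_flatten !all_Prop_map !all_Prop_iota.
split=> [[Psq [Pz [Peq Pcs]]]|[Psq Pz Peq Pcs]].
  split=> // [i j /Psq|a b /Peq]; first by rewrite all_Prop_map all_Prop_iota; apply.
  by rewrite all_Prop_flatten all_Prop_map all_Prop_iota; apply.
do !split=> //; move=> i lt_i.
  by rewrite all_Prop_map all_Prop_iota => j; apply: Psq.
by rewrite all_Prop_flatten all_Prop_map all_Prop_iota => j; apply: Peq.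
Qed.

Definition grid (M : seq nat -> valuation -> Prop) (g : valuation)
    (s : sym) (x y : valuation) : Prop :=
  match s with
  | Inc i => y = inc i x
  | Goal => y = x /\ x = g
  | Dom => y = x
  | Root => y = x /\ x = (fun=> 0)
  | Holds p => y = x /\ ev M p x
  end.

Lemma incC i j x : inc i (inc j x) = inc j (inc i x).
Proof.
rewrite /inc; case: (eqVneq i j) => [-> //|ij].
by rewrite !setr_neq 1?setrC // eq_sym.
Qed.

Lemma grid_grules M g k cs :
  clauses_hold M cs -> all_Prop (grule_holds (grid M g)) (grules k cs).
Proof.
move=> Mcs; apply/all_Prop_grules; split=> /=.
- move=> i j _ _ x _; exists (inc i x), (inc j (inc i x)), (inc j x).
  by do !split=> //; apply: incC.
- move=> a _; split=> [x [_ ->] //|].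
  rewrite all_Prop_map; apply/all_PropP => j; rewrite mem_filter => /andP[ja _] x [_ /= xa].
  by exists (inc j x); rewrite /inc setr_neq // eq_sym.
- move=> a b _ _; rewrite /eq_grules; case: eqP => [->|/eqP ab] //=.
  do 3?split=> [x [_] //=|].
  + by move=> ->.
  + by move=> xab; exists (inc a x); rewrite /inc setr_eq setr_neq 1?eq_sym // xab.
  + by move=> xab; exists (inc b x); rewrite /inc setr_eq setr_neq.
  rewrite all_Prop_map; apply/all_PropP => j; rewrite mem_filter.
  move=> /andP[/andP[ja jb] _] x [_ /= xab].
  by exists (inc j x); rewrite /inc !setr_neq // eq_sym.
- apply: all_Prop_impl Mcs => -[p i s|p i s|p q s] /= H x.
  + by move=> [_ /H Mx]; exists (inc i x).
  + by move=> y -> [_ /H].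
  + by move=> [_ px] [_ qx]; split=> //; apply: H.
Qed.

Definition clause_regs (c : clause) : seq nat :=
  let regs p := match p with
    | PZero a => [:: a] | PEq a b | PSucc a b => [:: a; b] | PName _ => [::] end in
  match c with
  | Up p i _ | Down p i _ => i :: regs p
  | Conj p q _ => regs p ++ regs q
  end.

(* Since the functions inc commute, the orbit of the root is the image of
   the valuations under a homomorphism. *)
Lemma grid_hom T (A : sym -> T -> T -> Prop) k cs c :
  all_Prop (grule_holds A) (grules k cs) ->
  all_Prop (fun c => all (fun i => i < k) (clause_regs c)) cs ->
  (forall i x y z, i < k -> A Dom x x -> A (Inc i) x y -> A (Inc i) x z -> y = z) ->
  A Dom c c -> A Root c c ->
  exists h : valuation -> T,
  [/\ h (fun=> 0) = c, forall x, A Dom (h x) (h x),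
      forall i x, i < k -> A (Inc i) (h x) (h (inc i x))
    & clauses_hold (fun s x => A (Holds (PName s)) (h x) (h x)) cs].
Proof.
move=> /all_Prop_grules[/= Psq Pz Peq Pcs] regs_k fun_A Dc Rc.
(* A choice of successors inside [Dom]; they exist by the square rule with both indices equal to
   [i]. *)
pose S i d := epsilon (inhabits c) (fun y => A (Inc i) d y /\ A Dom y y).
have SP i d : i < k -> A Dom d d -> A (Inc i) d (S i d) /\ A Dom (S i d) (S i d).
  move=> lt_i Dd.
  apply: (epsilon_spec (inhabits c) (fun y => A (Inc i) d y /\ A Dom y y)).
  by have [y [z [y' [? [? [? [? ?]]]]]]] := Psq i i lt_i lt_i d Dd; exists y.
have S_eq i d y : i < k -> A Dom d d -> A (Inc i) d y -> y = S i d.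
  by move=> lt_i Dd Iy; have [? _] := SP i d lt_i Dd; apply: fun_A Iy _.
have SC i j d : i < k -> j < k -> A Dom d d -> S i (S j d) = S j (S i d).
  move=> lt_i lt_j Dd.
  (* By functionality, both ways around the square at [d] follow [S], and they end in the same
     [z]. *)
  have [y [z [y' [Iy [Iz [Iy' [Iz' Dy]]]]]]] := Psq i j lt_i lt_j d Dd.
  have [_ DSj] := SP j d lt_j Dd.
  move: (S_eq i d y lt_i Dd Iy) (S_eq j d y' lt_j Dd Iy') => Ey Ey'.
  rewrite Ey in Iz Dy; rewrite Ey' in Iz'.
  by rewrite -(S_eq _ _ _ lt_i DSj Iz') -(S_eq _ _ _ lt_j Dy Iz).
(* The homomorphism applies [S i] exactly [x i] times for each [i < k]; arbitrary lists of registers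
   allow induction. *)
pose hl (x : valuation) l := foldr (fun i d => iter (x i) (S i) d) c l.
(* The premise [0 < x i] restricts the steps to nonzero registers, which is what lets zero and
   equality tests travel from the root. *)
have hl_ind (Q : T -> Prop) (x : valuation) l : {subset l <= iota 0 k} -> Q c ->
    (forall i d, i \in l -> 0 < x i -> A Dom d d -> Q d -> Q (S i d)) ->
    A Dom (hl x l) (hl x l) /\ Q (hl x l).
  elim: l => [|i l IHl] //= sub_l Qc QS.
  have [Dl Ql] : A Dom (hl x l) (hl x l) /\ Q (hl x l).
    apply: IHl => // [j jl|j d jl]; first by apply: sub_l; rewrite inE jl orbT.
    by apply: QS; rewrite inE jl orbT.
  have lt_i : i < k by have := sub_l i; rewrite mem_head mem_iota => /(_ isT).
  have {}QS d : 0 < x i -> A Dom d d -> Q d -> Q (S i d) by apply: QS; rewrite mem_head.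
  elim: (x i) QS => // n IHn QS.
  have [Dn Qn] := IHn (fun d _ => QS d isT).
  by split; [have [] := SP i _ lt_i Dn|apply: QS].
pose h x := hl x (iota 0 k).
have h_ind (Q : T -> Prop) (x : valuation) : Q c ->
    (forall i d, i < k -> 0 < x i -> A Dom d d -> Q d -> Q (S i d)) -> Q (h x).
  move=> Qc QS; apply: (proj2 (hl_ind Q x (iota 0 k) _ Qc _)) => // i d.
  by rewrite mem_iota; apply: QS.
have hD x : A Dom (h x) (h x).
  by have [] := hl_ind (fun=> True) x (iota 0 k).
have hS i x : i < k -> h (inc i x) = S i (h x).
  (* The additional application of [S i] commutes to the front past the later registers. *)
  suff hlS l : {subset l <= iota 0 k} -> uniq l ->
      hl (inc i x) l = if i \in l then S i (hl x l) else hl x l.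
    by move=> lt_i; rewrite /h hlS ?iota_uniq // mem_iota lt_i.
  elim: l => // j l IHl sub_l /= /andP[jl l_uniq].
  have {}sub_l m : m \in j :: l -> m < k by move=> /sub_l; rewrite mem_iota.
  have sub_l' : {subset l <= iota 0 k}.
    by move=> m ml; rewrite mem_iota sub_l // inE ml orbT.
  rewrite {}IHl // inE; case: eqP => [->|/eqP ij].
    by rewrite (negPf jl) /inc setr_eq.
  rewrite /inc setr_neq 1?eq_sym //; case: ifP => //= il.
  have [Dl _] : A Dom (hl x l) (hl x l) /\ True by apply: (hl_ind (fun=> True)).
  have lt_i := sub_l i; have lt_j := sub_l j.
  suff [] : A Dom (iter (x j) (S j) (hl x l)) (iter (x j) (S j) (hl x l)) /\
     iter (x j) (S j) (S i (hl x l)) = S i (iter (x j) (S j) (hl x l)) by [].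
  elim: (x j) => //= n [Dn ->]; split.
    by have [] := SP j _ (lt_j (mem_head _ _)) Dn.
  by rewrite SC // ?lt_j ?mem_head ?lt_i // inE il orbT.
have hI i x : i < k -> A (Inc i) (h x) (h (inc i x)).
  by move=> lt_i; rewrite hS //; have [] := SP i _ lt_i (hD x).
have h_next i x y : i < k -> A (Inc i) (h x) y -> y = h (inc i x).
  by move=> lt_i /(S_eq i _ y lt_i (hD x)) ->; rewrite hS.
(* The successor that the rule creates can only be the image of [inc i x]. *)
have up Q i x p : i < k -> grule_holds A (GUp p i Q) -> A p (h x) (h x) ->
    A Q (h (inc i x)) (h (inc i x)).
  by move=> lt_i H /H[y [/(h_next _ _ _ lt_i) ->]].
have upS Q i d p : i < k -> A Dom d d -> grule_holds A (GUp p i Q) -> A p d d ->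
    A Q (S i d) (S i d).
  by move=> lt_i Dd H /H[y [/(S_eq _ _ _ lt_i Dd) ->]].
have zeroP a x : a < k -> x a = 0 -> A (Holds (PZero a)) (h x) (h x).
  move=> /Pz[PR]; rewrite all_Prop_map => /all_PropP Pj xa.
  apply: (h_ind (fun d => A (Holds (PZero a)) d d)); first exact: PR.
  move=> i d lt_i xi Dd; apply: upS => //; apply: Pj.
  by rewrite mem_filter mem_iota /= add0n lt_i andbT; apply: contraTneq xi => ->; rewrite xa.
have eqP_ a b : a < k -> b < k -> forall x,
    (x a = x b -> A (Holds (PEq a b)) (h x) (h x)) /\
    (x a = (x b).+1 -> A (Holds (PSucc a b)) (h x) (h x)).
  move=> lt_a lt_b; have := Peq a b lt_a lt_b.
  rewrite /eq_grules; case: eqP => [<-|/eqP ab] /=.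
    move=> [PD _] x; split=> [_|]; first exact: PD.
    by move/eqP; rewrite ltn_eqF.
  move=> [PR [PS [PE]]]; rewrite all_Prop_map => /all_PropP Pj.
  have eqE x : x a = x b -> A (Holds (PEq a b)) (h x) (h x).
    move Em : (x b) => m; elim: m x Em => [|m IHm] x xb xa.
      apply: (h_ind (fun d => A (Holds (PEq a b)) d d)); first exact: PR.
      move=> i d lt_i xi Dd; apply: upS => //; apply: Pj.
      rewrite mem_filter mem_iota /= add0n lt_i andbT.
      by apply/andP; split; apply: contraTneq xi => ->; rewrite ?xa ?xb.
    (* Lower both registers by one, then regain [x] by incrementing [a], where successor holds, and
       then [b]. *)
    have -> : x = inc b (inc a (setr (setr x a m) b m)).
      apply: functional_extensionality => j.
      rewrite /inc /setr !eqxx (eq_sym b a) (negPf ab).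
      case: (eqVneq j b) => [-> //|_]; by case: (eqVneq j a) => [->|].
    apply: (up _ _ _ _ lt_b PE); apply: (up _ _ _ _ lt_a PS).
    by apply: IHm; rewrite ?setr_eq // setr_neq ?setr_eq.
  move=> x; split=> [|xab]; first exact: eqE.
  have -> : x = inc a (setr x a (x b)).
    by rewrite /inc setr_eq setr_setr -xab setr_id.
  by apply: (up _ _ _ _ lt_a PS); apply: eqE; rewrite setr_eq setr_neq // eq_sym.
(* The dummy clause [Conj p p [::]] gives access to the registers of [p]. *)
have evP p x : all (fun i => i < k) (clause_regs (Conj p p [::])) ->
    ev (fun s x => A (Holds (PName s)) (h x) (h x)) p x -> A (Holds p) (h x) (h x).
  case: p => [a|a b|a b|s] //=.
  - by move=> /andP[lt_a _]; apply: zeroP.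
  - by move=> /and3P[lt_a lt_b _]; have [] := eqP_ a b lt_a lt_b x.
  - by move=> /and3P[lt_a lt_b _]; have [] := eqP_ a b lt_a lt_b x.
exists h; split=> //.
  rewrite /h /hl; elim: (iota 0 k) => //= i l -> //.
apply: all_Prop_impl (all_Prop_and Pcs regs_k) => -[p i s|p i s|p q s] /=.
- move=> [H /andP[lt_i regs_p]] x /evP px; apply: (up _ _ _ _ lt_i H).
  by apply: px; rewrite all_cat regs_p.
- move=> [H /andP[lt_i regs_p]] x /evP px; apply: (H _ (h (inc i x))); first exact: hI.
  by apply: px; rewrite all_cat regs_p.
- rewrite all_cat => -[H /andP[regs_p regs_q]] x /evP px /evP qx.
  by apply: H; [apply: px; rewrite /= all_cat regs_p|apply: qx; rewrite /= all_cat regs_q].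
Qed.

(** * Facts and constraints *)

(** The last edge comes first, so lengthening the chain prepends an atom and its code is a primitive
    recursion on [n]. *)
Fixpoint chain (i o n : nat) (l : seq (sym * nat * nat)) : seq (sym * nat * nat) :=
  if n is m.+1 then (Inc i, o + m, (o + m).+1) :: chain i o m l else l.

Definition input_fact (a b : nat) : seq (sym * nat * nat) :=
  (Goal, a + b, a + b) :: chain 1 a b (chain 0 0 a [:: (Dom, 0, 0); (Root, 0, 0)]).

(* The m-th point of the path that makes a steps along register 0 and then
   continues along register 1. *)
Definition point (a m : nat) : valuation :=
  setr (setr (fun=> 0) 0 (minn m a)) 1 (m - a).

Lemma point0 a : point a 0 = (fun=> 0).
Proof.
apply: functional_extensionality => j; rewrite /point /setr min0n.
by case: ifP => // _; case: ifP.
Qed.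

Lemma inc_point a m : inc (if m < a then 0 else 1) (point a m) = point a m.+1.
Proof.
apply: functional_extensionality => -[|[|j]]; rewrite /inc /point /setr; case: ltnP => //= am.
- by rewrite (minn_idPl am).
- by rewrite (minn_idPr (leqW am)).
- by rewrite (eqP am); apply/eqP; rewrite subn_eq0 ltnW.
- by rewrite subSn.
Qed.

Lemma all_Prop_chain P i o n l : all_Prop P (chain i o n l) <->
  (forall m, m < n -> P (Inc i, o + m, (o + m).+1)) /\ all_Prop P l.
Proof.
elim: n => [|n IHn] /=; first by split=> [|[]].
rewrite IHn; split=> [[Pn [Pm Pl]]|[Pm Pl]].
  by split=> // m; rewrite ltnS leq_eqVlt => /predU1P[->|/Pm].
by split; [apply: Pm|split=> // m lt_m; apply: Pm; apply: ltnW].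
Qed.

Lemma all_Prop_input_fact P a b : all_Prop P (input_fact a b) <->
  [/\ P (Goal, a + b, a + b), P (Dom, 0, 0), P (Root, 0, 0) &
      forall m, m < a + b -> P (Inc (if m < a then 0 else 1), m, m.+1)].
Proof.
rewrite /= !all_Prop_chain /=; split=> [[PG [P1 [P0 [PD [PR _]]]]]|[PG PD PR Pm]].
  split=> // m lt_m; case: ltnP => [/P0|am]; first by rewrite add0n.
  by rewrite -{1 2}(subnKC am); apply: P1; rewrite ltn_subLR.
do !split=> //.
  by move=> m lt_m; have := Pm (a + m); rewrite ltn_add2l => /(_ lt_m); rewrite ltnNge leq_addr.
by move=> m lt_m; rewrite add0n; have := Pm m; rewrite lt_m; apply; apply: ltn_addr.
Qed.

Section Instance.
Variables (N k : nat) (cs : seq clause).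

Let atb s x y := FAtom (@binatom N bool s x y).

(** [Dom] guards the universal quantifier; the increment atom is repeated to supply both the guard
    and the body of the number quantifier. *)
Definition fun_form (i : nat) : form (binsig N) :=
  FAll false (FImp (atb Dom false false)
    (FLt 2 true (FAnd (atb (Inc i) false true) (atb (Inc i) false true)))).

Definition goal_form : form (binsig N) :=
  FAll false (FImp (atb Goal false false) (FNot (atb (Holds (PName [::])) false false))).

Definition constraint : form (binsig N) :=
  foldr (@FAnd _) goal_form (map fun_form (iota 0 k)).

Definition instance (a b : nat) : sat_input :=
  SatInput (map (@fact_atom N) (input_fact a b))
    (map (@grule_rule N) (grules k cs)) constraint.

Lemma arity_two_instance a b : arity_two (instance a b).
Proof. by move=> r; rewrite arity_binsig. Qed.

Lemma gc2_constraint : gc2 constraint.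
Proof.
rewrite /constraint; elim: (iota 0 k) => [|i l IHl] /=.
  apply: (@gc2_all _ [:: false]); first by rewrite arity_binsig.
    by move=> x.
  by apply: gc2_not; apply: gc2_atom; rewrite arity_binsig.
apply: gc2_and IHl; apply: (@gc2_all _ [:: false]); first by rewrite arity_binsig.
  by case.
by apply: gc2_lt => //; apply: gc2_atom; rewrite arity_binsig.
Qed.

Lemma sentence_constraint : sentence constraint.
Proof.
rewrite /constraint; elim: (iota 0 k) => [|i l IHl] x /=; first by case: x.
by rewrite negb_or IHl andbT; case: x.
Qed.

Lemma input_in_instance a b : input_in (@frontier_one) (instance a b).
Proof.
split; [|exact: gc2_constraint|exact: sentence_constraint].
by rewrite all_Prop_map; elim: (grules k cs) => //= r l; split=> //; apply: frontier_one_grule.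
Qed.

Lemma models_constraint (I : interp (binsig N)) :
  let A := @interp_rel N I in
  models I constraint <->
  (forall i x, i < k -> A Dom x x -> ~ at_least 2 (fun y => A (Inc i) x y)) /\
  (forall x, A Goal x x -> ~ A (Holds (PName [::])) x x).
Proof.
move=> A.
have fun_formP i (e : bool -> I) : holds e (fun_form i) <->
    forall x : I, A Dom x x -> ~ at_least 2 (fun y => A (Inc i) x y).
  rewrite /fun_form /=; split=> H x; move: (H x); rewrite atom_holds_binatom;
    move=> {}H /H; apply: contra_not => -[g [gI gP]]; exists g; split=> // j.
    by rewrite !atom_holds_binatom; split; apply: gP.
  by have := gP j; rewrite !atom_holds_binatom => -[].
have goal_formP (e : bool -> I) : holds e goal_form <->
    forall x : I, A Goal x x -> ~ A (Holds (PName [::])) x x.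
  by rewrite /=; split=> H x; move: (H x); rewrite !atom_holds_binatom.
have constraintP (e : bool -> I) : holds e constraint <->
   all_Prop (fun i => holds e (fun_form i)) (iota 0 k) /\ holds e goal_form.
  rewrite /constraint; elim: (iota 0 k) => [|i l IHl].
    by split=> [|[]].
  by rewrite [foldr _ _ _]/= [holds _ (FAnd _ _)]/= IHl /=; tauto.
split=> [H|[H1 H2] e].
  have [x0] := dom_inhabited I.
  have /constraintP[] := H (fun=> x0).
  rewrite goal_formP all_Prop_iota => H1 H2; split=> // i x lt_i.
  by have /fun_formP := H1 i lt_i; apply.
apply/constraintP; rewrite goal_formP all_Prop_iota; split=> // i lt_i.
by apply/fun_formP => x; apply: H1.
Qed.

End Instance.

(** * Correctness of the reduction *)

Lemma at_least2P T (P : T -> Prop) :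
  ~ at_least 2 P <-> forall y z, P y -> P z -> y = z.
Proof.
split=> [P2 y z Py Pz|P_eq [g [gI gP]]].
  have [// | yz] := classic (y = z).
  case: P2; exists (fun i : 'I_2 => if i == 0 :> nat then y else z).
  split=> [[[|[|i]] lti] [[|[|j]] ltj] //= Eij|i]; last by case: ifP.
  - by apply: val_inj.
  - by case: yz.
  - by apply: val_inj.
by have /gI := P_eq _ _ (gP ord0) (gP ord_max).
Qed.

Definition used_syms (k : nat) (cs : seq clause) : seq sym :=
  [:: Goal, Dom, Root, Holds (PName [::]), Inc 0, Inc 1
    & flatten (map grule_syms (grules k cs))].

(** Positions of the signature that code no symbol get the empty relation. *)
Definition grid_interp N (A : sym -> valuation -> valuation -> Prop) : interp (binsig N) :=
  @Interp (binsig N) valuation (inhabits (fun=> 0)) (fun r t =>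
    if sym_decode r is Some s then A s (nth (fun=> 0) t 0) (nth (fun=> 0) t 1) else False).

Lemma interp_rel_grid N A s x y : sym_code s <= N ->
  @interp_rel N (grid_interp N A) s x y <-> A s x y.
Proof. by move=> sN; rewrite /interp_rel /= val_symrel // sym_codeK. Qed.

Section Reduction.
Variables (N k : nat) (cs : seq clause) (M : seq nat -> valuation -> Prop).
Variable R : valuation -> Prop.
Hypothesis k_gt1 : 1 < k.
Hypothesis regs_k : all_Prop (fun c => all (fun i => i < k) (clause_regs c)) cs.
Hypothesis syms_N : all_Prop (fun s => sym_code s <= N) (used_syms k cs).
Hypothesis M_cs : clauses_hold M cs.
Hypothesis M_R : forall x, M [::] x <-> R x.
Hypothesis R_min : forall J, clauses_hold J cs -> forall x, R x -> J [::] x.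

(** If [R] fails at the end of the path, the grid over [M] is a model. Conversely, pulling a model
    back along the homomorphism of [grid_hom] gives a model of the clauses, so by minimality [R] at
    the end of the path would contradict the constraint. *)
Lemma satisfiable_instance a b :
  satisfiable (instance N k cs a b) <-> ~ R (point a (a + b)).
Proof.
rewrite /satisfiable /rules_hold /conj_holds.
split=> [[I [[v]]]|nR]; last first.
  pose A := grid M (point a (a + b)).
  have [sG [sD [sR [sN [s0 [s1 sr]]]]]] := syms_N.
  have {}sr : all_Prop (fun r => all_Prop (fun s => sym_code s <= N) (grule_syms r)) (grules k cs).
    by rewrite -all_Prop_map -all_Prop_flatten.
  exists (grid_interp N A); split.
  - exists (point a); rewrite all_Prop_map; apply/all_Prop_input_fact.
    split=> [||| m lt_m]; apply/atom_holds_binatom; rewrite interp_rel_grid //=.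
    + by rewrite point0.
    + by rewrite inc_point.
    + by case: ifP.
  - apply/models_constraint; split=> [i x lt_i _|x].
      have si : sym_code (Inc i) <= N.
        move: sr => /all_Prop_grules[H _ _ _].
        by have [_ [? _]] := H i i lt_i lt_i.
      by apply/at_least2P => y z; rewrite !interp_rel_grid //= => -> ->.
    by rewrite !interp_rel_grid //= => -[_ ->] [_ /M_R].
  - rewrite all_Prop_map.
    apply: all_Prop_impl (all_Prop_and sr (grid_grules (point a (a + b)) k M_cs)).
    move=> r [r_N Ar]; apply/rule_holds_grule.
    apply: (proj2 (grule_holds_ext _ r_N) Ar) => s x y.
    exact: interp_rel_grid.
rewrite all_Prop_map => /all_Prop_input_fact[].
rewrite !atom_holds_binatom => /= vG vD vR vI /models_constraint[fun_I goal_I].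
rewrite all_Prop_map => rules_I Rab.
have I_rules : all_Prop (grule_holds (@interp_rel N I)) (grules k cs).
  by apply: all_Prop_impl rules_I => r /rule_holds_grule.
have fun_I' i x y z : i < k -> interp_rel Dom x x ->
    interp_rel (Inc i) x y -> @interp_rel N I (Inc i) x z -> y = z.
  by move=> lt_i Dx; apply: (proj1 (at_least2P _) (fun_I i x lt_i Dx)).
have [h [h0 hD hI hcs]] := grid_hom I_rules regs_k fun_I' vD vR.
(* By functionality, the path of the fact must follow the image of the grid path. *)
have vh m : m <= a + b -> v m = h (point a m).
  elim: m => [|m IHm] lt_m; first by rewrite point0 h0.
  rewrite -inc_point; set i := if _ then _ else _.
  have lt_i : i < k by rewrite /i; case: ifP => _ //; apply: ltnW.
  apply: (fun_I' i (h (point a m))) => //; last exact: hI.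
  by rewrite -IHm 1?ltnW //; apply/atom_holds_binatom/vI.
apply: (goal_I (v (a + b))) => //.
by rewrite vh //; apply: (R_min hcs).
Qed.

End Reduction.

(** The constraint refutes this query in every model, so entailing it amounts to
    unsatisfiability. *)
Definition goal_query N : conj_atoms (binsig N) :=
  [:: binatom N Goal 0 0; binatom N (Holds (PName [::])) 0 0].

Lemma entailed_instance N k cs a b :
  entailed (@QAInput (instance N k cs a b) (goal_query N)) <->
  ~ satisfiable (instance N k cs a b).
Proof.
split=> [ent [I [[v Iv] Ic Ir]]|unsat I v Iv Ic Ir]; last first.
  by case: unsat; exists I; split=> //; exists v.
have [w] := ent I v Iv Ic Ir.
rewrite /conj_holds /= !atom_holds_binatom => -[wG [wM _]].
by have /models_constraint[_ /(_ _ wG)] := Ic.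
Qed.

(** * Computability of the code of the fact *)

Definition code_triple (a : sym * nat * nat) : nat :=
  CodeSeq.code [:: sym_code a.1.1; a.1.2; a.2].

(** A symbol in range sits at the position given by its code, so the code of the fact does not
    depend on [N]. *)
Lemma code_conj_fact N l :
  all_Prop (fun a => sym_code a.1.1 <= N) l ->
  code_conj (map (@fact_atom N) l) = CodeSeq.code (map code_triple l).
Proof.
move=> lN; rewrite /code_conj -map_comp; congr CodeSeq.code.
by elim: l lN => //= a l IHl [aN /IHl ->]; rewrite /code_triple -(val_symrel aN).
Qed.

Lemma computable_code_triple n (s : sym) (F G : n.-tuple nat -> nat) :
  computable F -> computable G -> computable (fun v => code_triple (s, F v, G v)).
Proof.
move=> cF cG.
do 3?[apply: computable_code_cons => //]; exact: computable_const.
Qed.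

Lemma computable_cons_triple n (s : sym) (F G : n.-tuple nat -> nat) l :
  computable F -> computable G -> computable (fun v => CodeSeq.code (map code_triple (l v))) ->
  computable (fun v => CodeSeq.code (map code_triple ((s, F v, G v) :: l v))).
Proof.
move=> cF cG cl.
exact: (computable_code_cons (computable_code_triple s cF cG) cl).
Qed.

(** Primitive recursion on the length, which is the first argument; offset and tail depend on the
    remaining ones. *)
Lemma computable_chain n i (o : n.-tuple nat -> nat) l :
  computable o -> computable (fun v => CodeSeq.code (map code_triple (l v))) ->
  computable (fun v : n.+1.-tuple nat =>
    CodeSeq.code (map code_triple
      (chain i (o [tuple of behead v]) (thead v) (l [tuple of behead v])))).
Proof.
move=> co cl.
(* The step function receives the counter, the previous code and then the parameters, so the latter
   are shifted by two. *)
pose o' (v : n.+2.-tuple nat) := o [tuple tnth v (lift ord0 (lift ord0 j)) | j < n] + thead v.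
have co' : computable o'.
  apply: computable_add; last exact: computable_proj.
  by apply: computable_comp co _ => j; apply: computable_proj.
have cG : computable (fun v : n.+2.-tuple nat =>
   CodeSeq.code (code_triple (Inc i, o' v, (o' v).+1) ::
      CodeSeq.decode (tnth v (lift ord0 ord0)))).
  apply: computable_code_cons.
    by apply: computable_code_triple => //; apply: computable_succ.
  apply: computable_ext (computable_proj (lift ord0 ord0)) => v.
  by rewrite CodeSeq.decodeK.
apply: (computable_prim (P := fun m v => CodeSeq.code (map code_triple (chain i (o v) m (l v)))) cl cG).
  by [].
move=> m v /=; rewrite [tnth _ _](tnth_nth 0) /= CodeSeq.codeK /o'.
do 3?congr (_ :: _).
suff -> : [tuple tnth [tuple of [:: m, CodeSeq.code (map code_triple (chain i (o v) m (l v))) & v]]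
    (lift ord0 (lift ord0 j)) | j < n] = v by [].
by apply: eq_from_tnth => j; rewrite tnth_mktuple !(tnth_nth 0).
Qed.

(** The argument [b] comes first because the outer chain recurses on it, with [a] as its offset. *)
Lemma computable_input_fact : computable (fun v : 2.-tuple nat =>
  CodeSeq.code (map code_triple (input_fact (tnth v ord_max) (thead v)))).
Proof.
have c0 : computable (fun v : 1.-tuple nat => CodeSeq.code (map code_triple
    (chain 0 0 (thead v) [:: (Dom, 0, 0); (Root, 0, 0)]))).
  apply: (@computable_chain 0 0 (fun=> 0) (fun=> [:: (Dom, 0, 0); (Root, 0, 0)]));
  exact: computable_const.
have c1 := computable_chain 1 (computable_proj ord0) c0.
have cab : computable (fun v : 2.-tuple nat => tnth v ord_max + thead v).
  by apply: computable_add; apply: computable_proj.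
apply: computable_ext (computable_cons_triple Goal cab cab c1) => v.
by case/tupleP: v => b v; case/tupleP: v => a v; rewrite !(tnth_nth 0).
Qed.

(** * Diagonalization *)

(* [code_sat] of an instance whose signature has code a and whose rules and
   constraint have joint code b, for the inputs a and b. *)
Definition diag_code (b a : nat) : nat :=
  CodeSeq.code [:: a, CodeSeq.code (map code_triple (input_fact a b)) & CodeSeq.decode b].

Lemma computable_diag_code :
  computable (fun v : 2.-tuple nat => diag_code (thead v) (tnth v ord_max)).
Proof.
apply: computable_code_cons; first exact: computable_proj.
apply: computable_code_cons; first exact: computable_input_fact.
apply: computable_ext (computable_proj ord0) => v.
by rewrite CodeSeq.decodeK.
Qed.

(** Self-reference is possible because the clauses for [g] are fixed before [a] and [b], which can
    then be the codes of the signature and of the rules and constraint built from these clauses. [P]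
    turns the code of the instance into the input of [f]. *)
Lemma diagonal_instance (f : recf 1) (P : nat -> nat) (w : nat) :
  computable (fun v : 1.-tuple nat => P (thead v)) ->
  exists N k cs a b, let i := instance N k cs a b in
  [/\ sym_code Goal <= N, sym_code (Holds (PName [::])) <= N &
      satisfiable i <-> ~ rec_eval f [tuple P (code_sat i)] w].
Proof.
move=> cP; have [p pE] := computable_comp1 cP computable_diag_code.
pose g := RComp f (fun _ : 'I_1 => p).
have gE v : rec_eval g v w <->
    rec_eval f [tuple P (diag_code (thead v) (tnth v ord_max))] w.
  split=> [[u [pu fu]]|fP] /=; last first.
    exists [tuple P (diag_code (thead v) (tnth v ord_max))]; split=> // i.
    by rewrite (ord1 i).
  apply: eq_rec_eval fu => //; case/tupleP: u pu => c u pu.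
  rewrite (tuple0 u) /=; congr [:: _].
  exact: rec_eval_det (pu ord0) (pE v).
(* At the end of the path, registers 0 and 1 contain [a] and [b]; [g] takes [b] first. Binding
   register 2 leaves the statement that [g] outputs [w]. *)
have := horn_and (@horn_rec_eval 2 g [tuple 1; 0] 2 isT) (horn_const 2 w).
move=> /(horn_ex 2) [cs [M [Mcs MR Rmin]]].
have [k0 lt_k0] := fresh (flatten (map clause_regs cs)).
(* Two more than the bound, to include registers 0 and 1 of the fact. *)
pose k := k0.+2.
have regs_k : all_Prop (fun c => all (fun i => i < k) (clause_regs c)) cs.
  elim: cs lt_k0 {Mcs Rmin} => //= c cs IHcs lt_k0; split.
    by apply/allP => i ic; do 2!apply: leqW; apply: lt_k0; rewrite mem_cat ic.
  by apply: IHcs => i ics; apply: lt_k0; rewrite mem_cat ics orbT.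
have [N leN] := fresh (map sym_code (used_syms k cs)).
have syms_N : all_Prop (fun s => sym_code s <= N) (used_syms k cs).
  elim: (used_syms k cs) leN => // s l IHl leN; split.
    by apply/ltnW/leN/mem_head.
  by apply: IHl => j jl; apply: leN; rewrite inE jl orbT.
pose a := CodeSeq.code (binsig N).
pose rest := [:: CodeSeq.code (map (@code_rule _) (map (@grule_rule N) (grules k cs)));
                code_form (constraint N k)].
pose b := CodeSeq.code rest.
exists N, k, cs, a, b => i; rewrite {}/i.
have code_i : code_sat (instance N k cs a b) = diag_code b a.
  rewrite /code_sat /diag_code CodeSeq.codeK -(@code_conj_fact N) //.
  apply/all_Prop_input_fact.
  by case: syms_N => [? [? [? [? [? [? _]]]]]]; split=> // m _; case: ifP.
have [sG [_ [_ [sM _]]]] := syms_N; split=> //.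
rewrite (satisfiable_instance _ regs_k syms_N Mcs MR Rmin) // code_i.
have pE0 : point a (a + b) 0 = a by rewrite /point /setr /= (minn_idPr (leq_addr b a)).
have pE1 : point a (a + b) 1 = b by rewrite /point /setr /= addKn.
have vE n : rec_eval g [tuple of map (setr (point a (a + b)) 2 n) [tuple 1; 0]] w <->
    rec_eval f [tuple P (diag_code b a)] w.
  rewrite gE.
  have -> : [tuple of map (setr (point a (a + b)) 2 n) [tuple 1; 0]] = [tuple b; a].
    by apply: val_inj; rewrite /= !setr_neq // pE0 pE1.
  by rewrite (tnth_nth 0).
split; apply: contra_not.
  by move=> fw; exists w; rewrite setr_eq vE.
by move=> [n]; rewrite setr_eq => -[gw wn]; rewrite wn vE in gw.
Qed.

Theorem theorem3p3 :
  destructive (@frontier_one) /\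
  ~ rec_decidable code_sat
      (fun i => input_in (@frontier_one) i /\ arity_two i) satisfiable.
Proof.
split=> [|[f f_dec]]; last first.
  (* With [w = 1], the instance is satisfiable iff the procedure does not declare it so. *)
  have [N [k [cs [a [b [_ _ sat]]]]]] := diagonal_instance (P := id) f 1 (computable_proj ord0).
  set i := instance N k cs a b in sat.
  have [f1 f0] := f_dec i (conj (input_in_instance N k cs a b) (@arity_two_instance N k cs a b)).
  have nsat : ~ satisfiable i by move=> s; case/sat: (s); apply: f1.
  have f0' := f0 nsat; apply: nsat; apply/sat => f1'.
  by have := rec_eval_det f1' f0'.
move=> [f f_dec].
(* The code of the query is the same for all [N], so it can be fixed before the instance is
   built. *)
pose q := CodeSeq.code [:: code_triple (Goal, 0, 0); code_triple (Holds (PName [::]), 0, 0)].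
have cP : computable (fun v : 1.-tuple nat => CodeSeq.code [:: thead v; q]).
  apply: computable_code_cons; first exact: computable_proj.
  exact: computable_const.
(* Here [w = 0], since the answer 0 denies entailment and so asserts satisfiability. *)
have [N [k [cs [a [b [sG sM sat]]]]]] := diagonal_instance (P := fun m => CodeSeq.code [:: m; q]) f 0 cP.
set i := instance N k cs a b in sat.
pose iq := @QAInput i (goal_query N).
have code_q : code_conj (goal_query N) = q.
  exact: (@code_conj_fact N [:: (Goal, 0, 0); (Holds (PName [::]), 0, 0)]).
have [f1 f0] := f_dec iq (input_in_instance N k cs a b).
have entP : entailed iq <-> ~ satisfiable i by apply: entailed_instance.
rewrite /code_qa code_q in f1 f0.
have sat_i : satisfiable i.
  apply/sat => f0'.
  have nsat : ~ satisfiable i by rewrite sat => /(_ f0').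
  by have := rec_eval_det f0' (f1 (proj2 entP nsat)).
by move/sat: (sat_i); apply; apply: f0 => /entP.
Qed.
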